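(* Let $M$ be a matroid of rank $r(M)$ on the ground set $E=[n]=\{1,\dots,n\}$, and let $C$ be a circuit of $M$. Then $$\beta_C=\sum_{t=|C|}^{r(M)+1}\beta_C(t),$$ where, for $|C|\le t\le r(M)+1$, $$\beta_C(t)=\frac{|C|}{n}\cdot|\mathcal{I}_{C,\,t-|C|}|\cdot\binom{n-1}{t-1}^{-1}.$$ Here $\mathcal{I}_{C,k}$ denotes the collection of all $k$-element subsets $S$ of $E\setminus C$ such that $C$ is the unique circuit of $M$ contained in $S\cup C$.
   Context: Matroid bingo: let $M$ be a matroid on a finite set $E$ with $|E|=n$ and circuit set $\mathcal{C}$. The elements of $E$ are called out one at a time in a uniformly random order $\sigma(1),\sigma(2),\dots,\sigma(n)$ (a uniformly random permutation of $E$). A circuit $C$ wins in round $t$ if $C\subseteq\{\sigma(1),\dots,\sigma(t)\}$ and no circuit of $M$ is contained in $\{\sigma(1),\dots,\sigma(t-1)\}$; thus the winner is the first circuit to be completed (the circuit axioms guarantee that there is no tie). $\beta_C(t)$ denotes the probability that $C$ wins in round $t$ ($1\le t\le n$), and $\beta_C$ denotes the probability that $C$ wins (in some round). *)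

(* Defs.v *)
(* MathComp *)
From HB Require Import structures.
From mathcomp Require Import all_boot all_order all_fingroup all_algebra.
Set Implicit Arguments.
Unset Strict Implicit.
Unset Printing Implicit Defensive.
Import GRing.Theory.
Local Open Scope ring_scope.

Record matroid (E : finType) := Matroid {
  indep : {set {set E}};
  indep0 : set0 \in indep;
  indep_sub : forall I J : {set E}, J \in indep -> I \subset J -> I \in indep;
  indep_aug : forall I J : {set E}, I \in indep -> J \in indep ->
    (#|I| < #|J|)%N -> exists2 e, e \in J :\: I & e |: I \in indep
}.

Definition circuits (E : finType) (M : matroid E) : {set {set E}} :=
  [set C : {set E} | minset (fun A : {set E} => A \notin indep M) C].

Definition rank (E : finType) (M : matroid E) : nat :=
  \max_(I in indep M) #|I|.

(* The family I_{C,k}. *)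
Definition unique_circuit_ext (E : finType) (M : matroid E) (C : {set E})
    (k : nat) : {set {set E}} :=
  [set S : {set E} | [&& S \subset ~: C, #|S| == k
     & [set D in circuits M | D \subset S :|: C] == [set C]]].

Definition uniform_prob (T : finType) (A : {set T}) : rat :=
  #|A|%:R / #|T|%:R.

(* The ground set [n] is 'I_n and the calls are numbered from 0, so the element
   called in round t >= 1 is s (t - 1): this is {s(1), ..., s(t)}. *)
Definition called (n : nat) (s : {perm 'I_n}) (t : nat) : {set 'I_n} :=
  [set s i | i : 'I_n & (i < t)%N].

(* Intended for rounds t >= 1. *)
Definition wins_in_round (n : nat) (M : matroid 'I_n) (C : {set 'I_n})
    (s : {perm 'I_n}) (t : nat) : bool :=
  (C \subset called s t)
  && [forall D in circuits M, ~~ (D \subset called s t.-1)].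

(* The rounds 1, ..., n are the i.+1 for i : 'I_n. *)
Definition wins (n : nat) (M : matroid 'I_n) (C : {set 'I_n})
    (s : {perm 'I_n}) : bool :=
  [exists i : 'I_n, wins_in_round M C s i.+1].

Definition beta_round (n : nat) (M : matroid 'I_n) (C : {set 'I_n})
    (t : nat) : rat :=
  uniform_prob [set s : {perm 'I_n} | wins_in_round M C s t].

Definition beta (n : nat) (M : matroid 'I_n) (C : {set 'I_n}) : rat :=
  uniform_prob [set s : {perm 'I_n} | wins M C s].

(* Main.v *)
(* Write t = u + 1.  The pair ("flag") formed by the element called in round t and
   the set of the u earlier calls is uniform among the n * 'C(n - 1, u) pairs (x, B)
   with x not in B and |B| = u, because permutations act transitively on them.
   Adding one element to an independent set creates at most one circuit, so C wins
   in round t iff this pair is (x, (S :|: C) :\ x) with x in C and S in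
   I_{C, t - |C|}; there are |C| * |I_{C, t - |C|}| such pairs. *)
Require Import Defs.
From HB Require Import structures.
From mathcomp Require Import all_boot all_order all_fingroup all_algebra.
Set Implicit Arguments.
Unset Strict Implicit.
Unset Printing Implicit Defensive.
Import GRing.Theory.
Local Open Scope ring_scope.

(** * Circuits, independence and the uniqueness of a newly created circuit *)

Section Circuits.
Variables (E : finType) (M : matroid E).
Implicit Types A B C D I J : {set E}.

Lemma circuit_dep C : C \in circuits M -> C \notin indep M.
Proof. by rewrite inE => /minsetp. Qed.

Lemma circuit_proper C A : C \in circuits M -> A \proper C -> A \in indep M.
Proof.
rewrite inE => /minsetP[_ minC] ltAC; apply: contraTT (ltAC) => /minC eqA.
by rewrite properE negb_and negbK (eqA (proper_sub ltAC)) subxx orbT.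
Qed.

Lemma circuit_sub_eq C D :
  C \in circuits M -> D \in circuits M -> C \subset D -> C = D.
Proof.
move=> hC hD sCD; apply/eqP; apply: contraNT (circuit_dep hC) => neCD.
by apply: circuit_proper hD _; rewrite properEneq neCD.
Qed.

Lemma circuit_gt0 C : C \in circuits M -> (0 < #|C|)%N.
Proof.
move=> /circuit_dep depC; rewrite card_gt0.
by apply: contraNneq depC => ->; apply: indep0.
Qed.

Lemma dep_circuit A : A \notin indep M -> exists2 C, C \in circuits M & C \subset A.
Proof.
move=> depA; have [] := minset_exists (P := fun B => B \notin indep M) depA.
by move=> C minC sCA; exists C => //; rewrite inE.
Qed.

(** This turns the second condition of [wins_in_round] into independence of the set of earlier
    calls. *)
Lemma indep_circuitsE A :
  (A \in indep M) = [forall D in circuits M, ~~ (D \subset A)].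
Proof.
apply/idP/forall_inP => [indA D hD | noD].
  by apply: contra (circuit_dep hD) => /(indep_sub indA).
by apply: contraT => /dep_circuit[D /noD/negP].
Qed.

Lemma indep_rank I : I \in indep M -> (#|I| <= rank M)%N.
Proof. exact: (leq_bigmax_cond (F := fun I : {set E} => #|I|)). Qed.

(** An independent set with [#|E|] elements would be the whole ground set and so contain [C]. The
    bound ensures that the rounds up to [rank M + 1] all exist. *)
Lemma rank_lt C : C \in circuits M -> (rank M < #|E|)%N.
Proof.
move=> hC; have C_gt0 := circuit_gt0 hC.
have E_gt0 : (0 < #|E|)%N := leq_trans C_gt0 (max_card _).
rewrite -(prednK E_gt0) ltnS; apply/bigmax_leqP => I indI.
rewrite -ltnS (prednK E_gt0) ltn_neqAle max_card andbT -cardsT.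
apply: contraNneq (circuit_dep hC) => eqI; apply: indep_sub indI _.
suff -> : I = setT by apply: subsetT.
by apply/eqP; rewrite eqEcard subsetT eqI /=.
Qed.

(** If [C] and [D] differ, take [f] in [C] but not in [D] and extend [C :\ f] to a maximal
    independent [J] inside [e |: I]. By augmentation [J] is as large as [I], which forces it to be
    [e |: I] without [f]; but that set contains [D]. *)
Lemma circuit_unique I e C D : I \in indep M ->
  C \in circuits M -> D \in circuits M ->
  C \subset e |: I -> D \subset e |: I -> C = D.
Proof.
move=> indI hC hD sC sD; apply/eqP/negPn/negP => neCD.
have /subsetPn[f fC fD] : ~~ (C \subset D).
  by apply: contra neCD => sCD; rewrite (circuit_sub_eq hC hD).
have eI : e \notin I.
  apply: contra (circuit_dep hC) => eI; apply: (indep_sub indI).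
  by apply: subset_trans sC _; rewrite subUset sub1set eI subxx.
pose P J := [&& J \in indep M, C :\ f \subset J & J \subset e |: I].
have PCf : P (C :\ f).
  rewrite /P subxx (circuit_proper hC) ?properD1 //=.
  exact: subset_trans (subD1set _ _) sC.
have [J /maxsetP[/and3P[indJ sCJ sJ] maxJ] _] := maxset_exists (P := P) PCf.
have fJ : f \notin J.
  apply: contra (circuit_dep hC) => fJ; apply: (indep_sub indJ).
  by rewrite -(setD1K fC) subUset sub1set fJ.
(* Otherwise augmentation adds an element of [I] to [J], and the larger set still satisfies [P]. *)
have leIJ : (#|I| <= #|J|)%N.
  rewrite leqNgt; apply/negP => /(indep_aug indJ indI)[x].
  rewrite inE => /andP[xJ xI] indxJ; case/negP: (xJ).
  rewrite -(maxJ (x |: J)) ?setU11 ?subsetUr //.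
  rewrite /P indxJ (subset_trans sCJ (subsetUr _ _)) subUset sub1set.
  by rewrite inE xI orbT.
have eqJ : J = (e |: I) :\ f.
  apply/eqP; rewrite eqEcard subsetD1 sJ fJ /=.
  have := cardsD1 f (e |: I); rewrite cardsU1 eI (subsetP sC f fC) !add1n => -[<-].
  exact: leIJ.
case/negP: (circuit_dep hD); apply: (indep_sub indJ).
by rewrite eqJ subsetD1 sD.
Qed.

End Circuits.

(** * Called sets under random permutations and the uniform distribution of flags *)

Section Calls.
Variable n : nat.
Implicit Types (s p : {perm 'I_n}) (u x : 'I_n) (B : {set 'I_n}).

Lemma calledE s t : called s t = s @: [set i : 'I_n | (i < t)%N].
Proof.
by apply/setP=> x; apply/imsetP/imsetP => -[i]; rewrite ?inE => hi ->;
  exists i => //; rewrite ?inE.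
Qed.

Lemma card_called s t : (t <= n)%N -> #|called s t| = t.
Proof.
move=> le_tn; rewrite calledE card_imset; last exact: perm_inj.
rewrite -sum1_card -[RHS]card_ord -sum1_card (big_ord_widen n (fun=> 1%N)) //.
by apply: eq_bigl => i; rewrite inE.
Qed.

(** The product applies [s] first, so right multiplication by [p] relabels the called elements and
    keeps the rounds. *)
Lemma calledM s p t : called (s * p)%g t = p @: called s t.
Proof.
by rewrite !calledE -imset_comp; apply: eq_imset => i; rewrite /= permM.
Qed.

Lemma called_sub s t t' : (t <= t')%N -> called s t \subset called s t'.
Proof.
move=> le_tt'; rewrite !calledE; apply: imsetS; apply/subsetP => i.
by rewrite !inE => /leq_trans; apply.
Qed.

Lemma calledS s u : called s u.+1 = s u |: called s u.
Proof.
rewrite !calledE -imsetU1.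
suff -> : [set i : 'I_n | (i < u.+1)%N] = u |: [set i : 'I_n | (i < u)%N] by [].
by apply/setP => i; rewrite !inE ltnS leq_eqVlt.
Qed.

Lemma notin_called s u : s u \notin called s u.
Proof. by rewrite calledE mem_imset ?inE ?ltnn //; apply: perm_inj. Qed.

Definition flag u s : 'I_n * {set 'I_n} := (s u, called s u).

Definition flags u : {set 'I_n * {set 'I_n}} :=
  [set f : 'I_n * {set 'I_n} | (f.2 \subset ~: [set f.1]) && (#|f.2| == u)].

Lemma flag_in u s : flag u s \in flags u.
Proof.
rewrite inE /=; apply/andP; split; last by apply/eqP/card_called/ltnW.
by rewrite subsetC sub1set inE notin_called.
Qed.

Lemma card_flags u : #|flags u| = (n * 'C(n.-1, u))%N.
Proof.
transitivity (\sum_(x : 'I_n)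
    \sum_(B in [set B : {set 'I_n} | B \subset ~: [set x] & #|B| == u]) 1)%N.
  by rewrite -sum1_card pair_big_dep; apply: eq_bigl => f; rewrite !inE.
rewrite (eq_bigr (fun=> 'C(n.-1, u))); first by rewrite sum_nat_const card_ord.
by move=> x _; rewrite sum1_card cards_draws cardsC1 card_ord.
Qed.

Lemma flag_surj u f : f \in flags u -> exists s, flag u s = f.
Proof.
case: f => x B; rewrite inE /= => /andP[sB /eqP cB].
have xB : x \notin B by rewrite subsetC sub1set inE in sB.
(* Calling [B] first, then [x], then all the rest puts [x] at index [#|B| = u]; reading [L] by
   position gives the permutation. *)
pose L := enum B ++ x :: enum (~: (x |: B)).
have uL : uniq L.
  rewrite cat_uniq /= !enum_uniq !mem_enum (negbTE xB) !inE eqxx /= andbT.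
  by apply/hasPn => y; rewrite /= !mem_enum !inE negb_or => /andP[].
have sL : size L = n.
  apply/eqP; rewrite -[X in _ == X]size_enum_ord; apply/eqP/perm_size.
  apply: uniq_perm; rewrite ?enum_uniq // => y.
  rewrite mem_cat inE !mem_enum !inE.
  by case: (y \in B); case: (y == x).
have injL : injective (fun i : 'I_n => nth x L i).
  by move=> i j /eqP; rewrite nth_uniq ?sL // => /eqP/val_inj.
exists (perm injL); congr (_, _).
  by rewrite permE /L nth_cat -cardE cB ltnn subnn.
apply/eqP; rewrite eqEcard (card_called _ (ltnW (ltn_ord u))) cB leqnn andbT calledE.
apply/subsetP => _ /imsetP[i + ->]; rewrite inE => lt_iu.
by rewrite permE /L nth_cat -cardE cB lt_iu -mem_enum mem_nth // -cardE cB.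
Qed.

(* The fibre of [flag u] over [flag u s0] is the right translate by [s0] of the
   fibre over [flag u 1]. *)
Lemma card_flag_fibre u f : f \in flags u ->
  #|[set s | flag u s == f]| = #|[set s | flag u s == flag u 1%g]|.
Proof.
move=> /flag_surj[s0 <-].
have act s p : flag u (s * p)%g = (p (flag u s).1, p @: (flag u s).2).
  by rewrite /flag permM calledM.
rewrite -[RHS](card_imset _ (mulIg s0)); apply: eq_card => s.
apply/idP/imsetP => [|[h]]; rewrite !inE.
  move=> /eqP eqs; exists (s * s0^-1)%g; last by rewrite mulgKV.
  by rewrite inE act eqs -act mulgV.
by move=> /eqP eqh ->; rewrite act eqh -act mul1g.
Qed.

Lemma card_flag_preim u (P : {set 'I_n * {set 'I_n}}) : P \subset flags u ->
  #|[set s | flag u s \in P]| = (#|P| * #|[set s | flag u s == flag u 1%g]|)%N.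
Proof.
move=> /subsetP sP; rewrite -sum1_card (partition_big (flag u) (mem P)) /=; last first.
  by move=> s; rewrite inE.
rewrite -sum_nat_const; apply: eq_bigr => f fP.
rewrite -(card_flag_fibre (sP f fP)) sum1_card; apply: eq_card => s.
by rewrite in_set unfold_in /= in_set andbC; case: (flag u s =P f) => //= ->.
Qed.

(** All permutations together form the preimage of [flags u], so the common fibre size cancels from
    the quotient. *)
Lemma uniform_prob_flag u (P : {set 'I_n * {set 'I_n}}) : P \subset flags u ->
  uniform_prob [set s | flag u s \in P] = #|P|%:R / (n * 'C(n.-1, u))%:R.
Proof.
move=> sP; rewrite /uniform_prob card_flag_preim //.
have -> : #|{perm 'I_n}| = #|[set s | flag u s \in flags u]|.
  by apply: eq_card => s; rewrite [RHS]in_set flag_in.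
rewrite card_flag_preim // card_flags !natrM -mulf_div divff ?mulr1 //.
(* The cancelled fibre size is nonzero because that fibre contains the identity. *)
rewrite Num.Theory.pnatr_eq0 -lt0n; apply/card_gt0P; exists 1%g.
by rewrite inE.
Qed.

End Calls.

(** * Wins as flags, and the rounds in which [C] can win *)

Section Winning.
Variables (n : nat) (M : matroid 'I_n) (C : {set 'I_n}).
Hypothesis hC : C \in circuits M.
Implicit Types (s : {perm 'I_n}) (u x : 'I_n) (S : {set 'I_n}).

Lemma unique_circuit_extP S k :
  reflect [/\ [disjoint S & C], #|S| = k
            & forall D, D \in circuits M -> D \subset S :|: C -> D = C]
          (S \in unique_circuit_ext M C k).
Proof.
rewrite inE -disjoints_subset; apply: (iffP and3P) => -[dSC /eqP cS].
  move=> /eqP/setP uC; split=> // D hD sD.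
  by have := uC D; rewrite in_set in_set1 hD sD => /esym/eqP.
move=> uC; split=> //; apply/eqP/setP => D; rewrite inE in_set1.
by apply/andP/eqP => [[] /uC // | ->]; rewrite hC subsetUr.
Qed.

Definition winning_flags k : {set 'I_n * {set 'I_n}} :=
  [set (p.1, (p.2 :|: C) :\ p.1) | p in setX C (unique_circuit_ext M C k)].

(** The parametrisation is injective: [x] is the first component, and since [x] lies in [C] and [S]
    avoids [C], deleting [C] from the second component returns [S]. *)
Lemma card_winning_flags k :
  #|winning_flags k| = (#|C| * #|unique_circuit_ext M C k|)%N.
Proof.
rewrite card_in_imset ?cardsX // => -[x S] [y T] /setXP[/= xC].
move=> /unique_circuit_extP[dS _ _] /setXP[/= yC] /unique_circuit_extP[dT _ _].
case=> eqxy /(congr1 (fun A : {set 'I_n} => A :\: C)); rewrite -eqxy.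
have restrict (A : {set 'I_n}) : [disjoint A & C] -> (A :|: C) :\ x :\: C = A.
  move=> /setDidPl dA; rewrite -[RHS]dA; apply/setP => z; rewrite !inE.
  case: (boolP (z \in C)) => //= zC; rewrite orbF.
  by case: (z =P x) zC => // ->; rewrite xC.
by rewrite !restrict // => ->.
Qed.

Lemma winning_flags_sub u : (#|C| <= u.+1)%N ->
  winning_flags (u.+1 - #|C|) \subset flags u.
Proof.
move=> leCu; apply/subsetP => _ /imsetP[[x S] /setXP[/= xC] /unique_circuit_extP[dS cS _] ->].
rewrite inE /=.
rewrite subsetC sub1set !inE eqxx /=.
(* The hypothesis [#|C| <= u.+1] makes the truncated subtraction exact, so [S :|: C] has [u.+1]
   elements. *)
have := cardsD1 x (S :|: C); rewrite inE xC orbT cardsU disjoint_setI0 //.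
by rewrite cards0 subn0 cS subnK // => -[->].
Qed.

Lemma wins_in_roundE u s : (#|C| <= u.+1)%N ->
  wins_in_round M C s u.+1 = (flag u s \in winning_flags (u.+1 - #|C|)).
Proof.
move=> leCu; rewrite /wins_in_round -indep_circuitsE /=; apply/andP/imsetP.
  move=> [sC indu]; have sUC : called s u.+1 :\: C :|: C = called s u.+1.
    by rewrite setUC -{1}(setIidPr sC) setID.
  (* If the last call were outside [C], then [C] would lie in the independent set of earlier
     calls. *)
  have suC : s u \in C.
    apply: contraNT (circuit_dep hC) => suC; apply: indep_sub indu _.
    apply/subsetP => y yC; have := subsetP sC y yC; rewrite calledS in_setU1.
    by case: eqP => // eqy; rewrite -eqy yC in suC.
  exists (s u, called s u.+1 :\: C) => /=.
    rewrite inE suC /=; apply/unique_circuit_extP; split.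
    - by rewrite disjoint_sym disjoints_subset setCD subsetUr.
    - by rewrite cardsDS // card_called.
    - by rewrite sUC calledS in sC * => D hD sD; apply: circuit_unique indu _ _ sD sC.
  by rewrite /flag sUC calledS setU1K // notin_called.
move=> [[x S] /setXP[/= xC] /unique_circuit_extP[dS cS uC] [eqx eqB]].
rewrite calledS eqx eqB setD1K ?inE ?xC ?orbT // subsetUr; split=> //.
(* A circuit among the earlier calls lies in [S :|: C], hence equals [C]; but [x] in [C] has not yet
   been called. *)
rewrite indep_circuitsE; apply/forall_inP => D hD.
apply/negP; rewrite subsetD1 => /andP[sD xD].
by rewrite (uC D hD sD) xC in xD.
Qed.

(** The [t] called elements include [C], and the [t - 1] earlier ones are independent. *)
Lemma wins_in_round_bounds s t : (0 < t <= n)%N -> wins_in_round M C s t ->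
  (#|C| <= t <= rank M + 1)%N.
Proof.
case: t => // t lt_tn /andP[sC]; rewrite -indep_circuitsE /= => /indep_rank.
rewrite (card_called _ (ltnW lt_tn)) => ler.
by rewrite addn1 ltnS ler andbT -(card_called s lt_tn) subset_leq_card.
Qed.

Lemma wins_in_round_unique s t t' :
  wins_in_round M C s t -> wins_in_round M C s t' -> (t' <= t)%N.
Proof.
move=> /andP[sC _] /andP[_ /forall_inP/(_ C hC)]; apply: contraNT; rewrite -ltnNge.
by case: t' => // t'; rewrite ltnS => /(called_sub s); apply: subset_trans.
Qed.

(** A permutation has at most one round in which [C] wins, so the events of the single rounds are
    disjoint and their sizes add up. *)
Lemma beta_sum_rounds : beta M C = \sum_(1 <= t < n.+1) beta_round M C t.
Proof.
rewrite big_add1 big_mkord /= /beta /beta_round /uniform_prob -mulr_suml -natr_sum.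
congr (_%:R / _).
under eq_bigr do rewrite -sum1_card.
rewrite -partition_disjoint_bigcup ?sum1_card.
  apply: eq_card => s; rewrite inE; apply/existsP/bigcupP.
    by move=> [i wi]; exists i => //; rewrite inE.
  by move=> [i _]; rewrite inE => wi; exists i.
move=> i j; apply: contraNT => /pred0Pn[s /=]; rewrite !inE => /andP[wi wj].
have := wins_in_round_unique wi wj; have := wins_in_round_unique wj wi.
by rewrite !ltnS -(inj_eq val_inj) eqn_leq => -> ->.
Qed.

End Winning.

Theorem theorem2 (n : nat) (M : matroid 'I_n) (C : {set 'I_n})
    (hC : C \in circuits M) :
  beta M C = \sum_(#|C| <= t < (rank M + 1).+1) beta_round M C t
  /\ (forall t : nat, (#|C| <= t <= rank M + 1)%N ->
        beta_round M C t =
          #|C|%:R / n%:R * #|unique_circuit_ext M C (t - #|C|)|%:R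
            * ('C(n.-1, t.-1)%:R)^-1).
Proof.
have C_gt0 := circuit_gt0 hC.
have := rank_lt hC; rewrite card_ord -addn1 => le_rn.
split=> [|t /andP[leCt letr]].
  (* The sum in the statement is widened to the rounds from 1 to [n]; the added terms vanish because
     [C] cannot win there. *)
  rewrite beta_sum_rounds // (big_nat_widenl _ _ _ _ _ C_gt0).
  rewrite (big_nat_widen _ _ n.+1) ?ltnS //= [RHS]big_mkcond /=.
  apply: eq_big_nat => t t_n; case: ifPn => // out.
  rewrite /beta_round /uniform_prob eq_card0 ?mul0r // => s.
  rewrite [LHS]in_set; apply: contraNF out; rewrite ltnS.
  exact: wins_in_round_bounds.
(* Round 0 is excluded since [C] is nonempty; round [t.+1] has the zero-based index [t], which is
   below [n] by the rank bound. *)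
case: t leCt letr => [|t] leCt letr; first by rewrite leqNgt C_gt0 in leCt.
pose u := Ordinal (leq_trans letr le_rn).
rewrite /beta_round.
under eq_finset do rewrite (wins_in_roundE hC (u := u)) //.
rewrite uniform_prob_flag ?winning_flags_sub // card_winning_flags //.
by rewrite !natrM invfM mulrACA mulrA.
Qed.
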